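(* Let $p\in[0,1]$ and let $\mu$ be a translation invariant stationary (TIS) measure with density $\rho$ for the facilitated asymmetric exclusion process (F-ASEP) on $\mathbb{Z}$ with asymmetry parameter $p$. Then: (a) If $\rho<1/2$ then $\mu(F)=1$, i.e. $\mu$ is supported on $F$. (b) If $\rho=1/2$ then $\mu=\mu^*$. (c) If $\rho>1/2$ then $\mu(G)=1$, i.e. $\mu$ is supported on $G$.
   Context: Configurations are $\eta\in X=\{0,1\}^{\mathbb{Z}}$ ($1$ = particle, $0$ = hole). The F-ASEP with parameter $p\in[0,1]$ is the continuous-time Markov process on $X$ in which a particle at $i$ jumps to $i+1$ at rate $p$ if $\eta(i-1)=\eta(i)=1$ and $\eta(i+1)=0$, and a particle at $i$ jumps to $i-1$ at rate $1-p$ if $\eta(i+1)=\eta(i)=1$ and $\eta(i-1)=0$. Its generator acts on functions $f$ depending on finitely many sites by $Lf(\eta)=\sum_{i}c(i,\eta)[f(\eta^{i,i+1})-f(\eta)]$, where $\eta^{i,i+1}$ is $\eta$ with the values at $i,i+1$ exchanged, $c(i,\eta)=p$ if $\eta(i-1)=\eta(i)=1,\eta(i+1)=0$, $c(i,\eta)=1-p$ if $\eta(i)=0,\eta(i+1)=\eta(i+2)=1$, and $c(i,\eta)=0$ otherwise; $S(t)=e^{Lt}$ is the associated semigroup, acting on measures by $(\mu S(t))(f)=\mu(S(t)f)$. A TIS measure is a translation invariant Borel probability measure $\mu$ on $X$ with $\mu S(t)=\mu$ for all $t\ge0$. A translation invariant measure $\mu$ has density $\rho$ if $\lim_{N\to\infty}\frac1{2N+1}\sum_{i=-N}^N\eta(i)=\rho$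 for $\mu$-almost every $\eta$. $F\subset X$ is the set of (frozen) configurations in which no two adjacent sites are occupied, and $G\subset X$ is the set of configurations in which no two adjacent sites are empty. $\tau$ is translation, $(\tau\eta)(i)=\eta(i-1)$. $\eta^*\in X$ is defined by $\eta^*(i)=i\bmod 2$, and $\mu^*=\frac12(\delta_{\eta^*}+\delta_{\tau\eta^*})$. *)

(* Defs.v *)
From HB Require Import structures.
From mathcomp Require Import all_boot all_order all_algebra.
From mathcomp Require Import all_classical all_reals all_analysis.

Set Implicit Arguments.
Unset Strict Implicit.
Unset Printing Implicit Defensive.

Import Order.TTheory GRing.Theory Num.Theory.
Import numFieldNormedType.Exports.

Local Open Scope classical_set_scope.
Local Open Scope ring_scope.

(* true = particle, false = hole. The topology is the product topology, and
   the sigma-algebra is its Borel sigma-algebra. *)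
Definition config : Type := {ptws int -> bool}.

HB.instance Definition _ := Pointed.copy config {ptws int -> bool}.
HB.instance Definition _ := Topological.copy config {ptws int -> bool}.
HB.instance Definition _ :=
  Measurable.copy config (g_sigma_algebraType (@open {ptws int -> bool})).

Definition exchange (i : int) (eta : config) : config :=
  fun j => if j == i then eta (i + 1) else
           if j == i + 1 then eta i else eta j.

Definition translate (eta : config) : config := fun i => eta (i - 1).

(* Configurations with no two adjacent particles. *)
Definition frozen : set config :=
  [set eta | forall i : int, ~~ (eta i && eta (i + 1))].

(* Configurations with no two adjacent holes. *)
Definition no_adjacent_holes : set config :=
  [set eta | forall i : int, eta i || eta (i + 1)].

Definition eta_star : config := fun i => (i %% 2)%Z == 1.

Definition mu_star (R : realType) : {measure set config -> \bar R} :=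
  mscale (2^-1 : R)%:nng (measure_add \d_eta_star \d_(translate eta_star)).

Definition fasep_rate (R : realType) (p : R) (i : int) (eta : config) : R :=
  if [&& eta (i - 1), eta i & ~~ eta (i + 1)] then p
  else if [&& ~~ eta i, eta (i + 1) & eta (i + 2)] then 1 - p
  else 0.

Definition cylinder (R : realType) (f : config -> R) : Prop :=
  exists s : seq int, forall eta xi : config,
    (forall i, i \in s -> eta i = xi i) -> f eta = f xi.

(* The operator L. For a cylinder function f only finitely many terms are
   nonzero, so that the finitely supported sum is the sum over all of Z. *)
Definition fasep_op (R : realType) (p : R) (f : config -> R) : config -> R :=
  fun eta => \sum_(i \in [set: int])
    fasep_rate p i eta * (f (exchange i eta) - f eta).

(* Markov (Feller) semigroups on the Banach space C(config) with the sup norm.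
   The operators are total on config -> R; only their values at continuous
   functions and times t >= 0 are meaningful. *)
Record markov_semigroup (R : realType)
    (S : R -> (config -> R) -> (config -> R)) : Prop := MarkovSemigroup {
  msg_continuous : forall (t : R) (f : config -> R),
    0 <= t -> continuous f -> continuous (S t f);
  msg_linear : forall (t a : R) (f g : config -> R),
    0 <= t -> continuous f -> continuous g ->
    S t (fun eta => a * f eta + g eta) = (fun eta => a * S t f eta + S t g eta);
  msg_pos : forall (t : R) (f : config -> R), 0 <= t -> continuous f ->
    (forall eta, 0 <= f eta) -> forall eta, 0 <= S t f eta;
  msg_one : forall t : R, 0 <= t -> S t (cst 1) = cst 1;
  msg_zero : forall f : config -> R, continuous f -> S 0 f = f;
  msg_add : forall (s t : R) (f : config -> R),
    0 <= s -> 0 <= t -> continuous f -> S (s + t) f = S s (S t f);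
  msg_right_continuous : forall (t : R) (f : config -> R),
    0 <= t -> continuous f -> {uniform, S s f @[s --> t^'+] --> S t f}
}.

(* (f, g) belongs to the graph of the infinitesimal generator of S. *)
Definition generator_graph (R : realType)
    (S : R -> (config -> R) -> (config -> R)) (f g : config -> R) : Prop :=
  [/\ continuous f, continuous g &
      {uniform, (fun eta => t^-1 * (S t f eta - f eta)) @[t --> 0^'+] --> g}].

(* (f, g) belongs to the closure, in C(config) * C(config), of the graph of L
   on cylinder functions. *)
Definition fasep_closure_graph (R : realType) (p : R) (f g : config -> R) :
    Prop :=
  exists u : nat -> config -> R,
    [/\ forall n, cylinder (u n), {uniform, u n @[n --> \oo] --> f} &
        {uniform, fasep_op p (u n) @[n --> \oo] --> g}].

(* S(t) = e^{Lt}: the Markov semigroup whose generator is the closure of L. By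
   Liggett's theorem (the rates are bounded and of finite range) it exists, and
   it is unique on C(config) by the Hille-Yosida theorem. *)
Definition fasep_semigroup (R : realType) (p : R)
    (S : R -> (config -> R) -> (config -> R)) : Prop :=
  markov_semigroup S /\
  forall f g : config -> R, generator_graph S f g <-> fasep_closure_graph p f g.

Definition translation_invariant (R : realType) (mu : probability config R) :
    Prop :=
  forall A : set config, measurable A -> mu (translate @^-1` A) = mu A.

(* mu S(t) = mu for all t >= 0, where mu S(t) is the measure with
   (mu S(t))(f) = mu(S(t) f) for all f in C(config). *)
Definition stationary (R : realType)
    (S : R -> (config -> R) -> (config -> R)) (mu : probability config R) :
    Prop :=
  forall (t : R) (f : config -> R), 0 <= t -> continuous f ->
    (\int[mu]_eta (S t f eta)%:E = \int[mu]_eta (f eta)%:E)%E.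

Definition TIS (R : realType)
    (S : R -> (config -> R) -> (config -> R)) (mu : probability config R) :
    Prop :=
  translation_invariant mu /\ stationary S mu.

(* The index k of the sum stands for the site i = k - N in [-N, N]. *)
Definition has_density (R : realType) (mu : probability config R) (rho : R) :
    Prop :=
  {ae mu, forall eta : config,
    ((2 * N + 1)%:R^-1 * \sum_(k < 2 * N + 1) (eta (k%:Z - N%:Z))%:R : R)
      @[N --> \oo] --> rho}.

(* Main.v *)
(** When a pair 11 hops, it either moves by two sites or, if it runs into a pair
    00, annihilates with it: 1100 becomes 1010. A translation invariant
    stationary measure therefore gives probability 0 to 1100 if p > 0 and to
    0011 if p < 1. An event from which a null event is reached at positive rate
    is null, so by induction on the distance no 11 has a 00 ahead of it, in a
    direction in which particles move. By translation invariance, if 11 occurs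
    then it occurs arbitrarily far behind any site; hence almost surely 11 and
    00 do not both occur, i.e. the configuration is frozen or has no adjacent
    holes. For a translation invariant set A, averaging over windows gives
    mu(eta i = 1, A) = rho mu(A). Applied to the two sets, this compares rho
    with 1/2, and for rho = 1/2 it forces eta to alternate almost surely. *)

Require Import Defs.
From mathcomp Require Import all_boot all_order all_algebra.
From mathcomp Require Import all_classical all_reals all_analysis.
From mathcomp Require Import measurable_realfun lra zify.

Import Order.TTheory GRing.Theory Num.Theory.
Import numFieldNormedType.Exports.

Local Open Scope classical_set_scope.
Local Open Scope ring_scope.

(** * Cylinder events and continuous functions on the compact space of configurations *)

Definition determined_by (s : seq int) (P : config -> bool) : Prop :=
  forall eta xi : config, (forall i, i \in s -> eta i = xi i) -> P eta = P xi.

(** Coordinates are continuous into the discrete space [bool], so agreeing with [eta] on the finite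
    list [s] is a neighbourhood of [eta]. *)
Lemma open_determined_by (s : seq int) (P : config -> bool) :
  determined_by s P -> open [set eta | P eta].
Proof.
move=> sP; rewrite openE => eta Peta; rewrite /interior.
have near_s : nbhs eta [set xi : config | forall i, i \in s -> xi i = eta i].
  elim: s {sP} => [|i s ih]; first exact: (filterS _ filterT).
  have near_i : nbhs eta [set xi : config | xi i = eta i].
    have near_i := @proj_continuous int (fun=> bool) i eta.
    by apply: (near_i [set eta i]); exact: (@discrete_set1 bool).
  apply: filterS2 near_i ih => xi xii xis j.
  by rewrite inE => /predU1P[->|]; [|exact: xis].
by apply: filterS near_s => xi xis /=; rewrite (sP _ eta).
Qed.

Lemma measurable_determined_by (s : seq int) (P : config -> bool) :
  determined_by s P -> measurable [set eta | P eta].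
Proof. by move=> /open_determined_by; exact: sub_sigma_algebra. Qed.

Lemma compact_config : compact [set: config].
Proof.
have := @tychonoff int (fun=> bool) (fun=> setT) (fun=> bool_compact).
by congr (compact _); rewrite eqEsubset.
Qed.

Section Integrability.
Context {R : realType} (mu : probability config R).

Lemma continuous_measurable_config (f : config -> R) :
  continuous f -> measurable_fun setT f.
Proof.
move=> /continuousP cf; apply: (measurability _ (RGenOpens.measurableE R)).
move=> _ [_ [a [b ->] <-]]; rewrite setTI.
by apply: sub_sigma_algebra; exact/cf/interval_open.
Qed.

(** A continuous function on a compact space is bounded, and [mu] is finite. *)
Lemma continuous_integrable (f : config -> R) :
  continuous f -> mu.-integrable setT (EFin \o f).
Proof.
move=> cf; apply: measurable_bounded_integrable => //.
- by apply: (le_lt_trans (probability_le1 mu _)); rewrite ?ltry.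
- exact: continuous_measurable_config.
- have /compact_bounded[M [Mr MP]] :=
    continuous_compact (continuous_subspaceT cf) compact_config.
  by exists M; split => // x Mx y _; apply: MP => //; exists y.
Qed.

End Integrability.

(** * The generator on cylinder functions and the identity given by stationarity *)

Section StationaryMeasure.
Context {R : realType} (p : R).

(** Bonds whose exchange leaves [f] unchanged contribute zero, so the sum reduces to any list that
    contains all the others. *)
Lemma fasep_op_seq (r : seq int) (f : config -> R) (eta : config) :
  uniq r -> (forall i, i \notin r -> f (exchange i eta) = f eta) ->
  fasep_op p f eta =
  \sum_(i <- r) fasep_rate p i eta * (f (exchange i eta) - f eta).
Proof.
move=> ur fr; rewrite fsbig_seq//; apply/esym/fsbig_widen => // i [_ /= ri].
by rewrite fr ?subrr ?mulr0//; apply/negP.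
Qed.

(* The left ends i of the bonds {i, i + 1} that meet s. *)
Definition bonds (s : seq int) : seq int := undup (s ++ [seq i - 1 | i <- s]).

Lemma exchange_notin_bonds (s : seq int) (P : config -> bool) (i : int)
    (eta : config) :
  determined_by s P -> i \notin bonds s -> P (exchange i eta) = P eta.
Proof.
move=> sP; rewrite mem_undup mem_cat negb_or => /andP[si si1].
apply: sP => j sj; rewrite /exchange ifN; last by apply: contraNneq si => <-.
rewrite ifN//; apply: contraNneq si1 => ji; apply/mapP; exists j => //.
by rewrite ji addrK.
Qed.

Lemma uniq_bonds s : uniq (bonds s).
Proof. exact: undup_uniq. Qed.

Context (p01 : 0 <= p <= 1).

Lemma fasep_rate01 i eta : 0 <= fasep_rate p i eta <= 1.
Proof.
case/andP: p01 => p0 p1.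
by rewrite /fasep_rate; case: ifP => _; [|case: ifP => _]; apply/andP; lra.
Qed.

Context (S : R -> (config -> R) -> (config -> R)) (hS : fasep_semigroup p S).
Context (mu : probability config R) (mu_TIS : TIS S mu).

(** The constant sequence [f] witnesses membership in the closure. Besides the limit, this yields
    continuity of [f] and of [fasep_op p f]. *)
Lemma generator_cylinder (f : config -> R) :
  cylinder f -> generator_graph S f (fasep_op p f).
Proof.
move=> cf; apply/(hS.2 _ _); exists (fun=> f).
split => //; exact: (@cvg_cst {uniform config -> R}).
Qed.

(** By stationarity the difference quotients of [S t f] have integral 0, and they converge uniformly
    to [fasep_op p f]. *)
Lemma integral_fasep_op (f : config -> R) :
  cylinder f -> \int[mu]_eta fasep_op p f eta = 0.
Proof.
move=> /generator_cylinder[cf cLf lim_f]; set g := fasep_op p f in cLf lim_f *.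
apply/eqP; rewrite -normr_eq0 eq_le normr_ge0 andbT.
apply/ler_addgt0Pl => e e0; rewrite addr0.
have near_e : nbhs (g : {uniform config -> R})
    [set h : config -> R | forall eta, `|g eta - h eta| < e].
  apply/uniform_nbhs; exists [set xy | ball xy.1 e xy.2].
  by split; [exact: (entourage_ball _ (PosNum e0))|move=> h /= + eta; apply].
(* A single time suffices: one whose difference quotient is within [e] of [g] everywhere. *)
have [t [t0 te]] : exists t : R, 0 < t /\
    forall eta, `|g eta - t^-1 * (S t f eta - f eta)| < e.
  have /= near_t := lim_f _ near_e.
  have [t []] := filter_ex (filterI (nbhs_right_gt (0 : R)) near_t).
  by exists t.
have cSf : continuous (S t f) by apply: (msg_continuous hS.1) => //; exact: ltW.
have iSf := continuous_integrable mu _ cSf.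
have if_ := continuous_integrable mu _ cf.
have ig := continuous_integrable mu _ cLf.
pose h eta := t^-1 * (S t f eta - f eta).
have iSB : mu.-integrable setT (EFin \o (fun eta => S t f eta - f eta)).
  exact: (integrableB measurableT iSf if_).
have ih : mu.-integrable setT (EFin \o h).
  exact: (integrableZl measurableT t^-1 iSB).
have h0 : \int[mu]_eta h eta = 0.
  rewrite RintegralZl// RintegralB// {1}/Rintegral.
  by rewrite (mu_TIS.2 t f (ltW t0) cf) subrr mulr0.
have -> : \int[mu]_eta g eta = \int[mu]_eta (g eta - h eta).
  by rewrite RintegralB// h0 subr0.
have igh : mu.-integrable setT (EFin \o (fun eta => g eta - h eta)).
  exact: (integrableB measurableT ig ih).
apply: (le_trans (le_normr_Rintegral _ igh)) => //.
have <- : \int[mu]_(eta in setT) e = e.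
  rewrite Rintegral_cst// -[RHS]mulr1; apply: f_equal.
  exact: (f_equal fine (probability_setT mu)).
apply: le_Rintegral => //.
- exact: integrable_norm igh.
- by apply: (continuous_integrable mu (cst e)) => ?; exact: cvg_cst.
- by move=> eta _; exact: ltW.
Qed.

Lemma cylinder_determined_by (s : seq int) (P : config -> bool) :
  determined_by s P -> cylinder (fun eta => (P eta)%:R : R).
Proof. by move=> sP; exists s => eta xi /sP ->. Qed.

(** Real-valued, so that linear arithmetic applies; [fine] loses nothing because [mu] is finite. *)
Definition prob (P : config -> bool) : R := fine (mu [set eta | P eta]).

Lemma natr_indic (P : config -> bool) :
  (fun eta => (P eta)%:R) = \1_[set eta | P eta] :> (config -> R).
Proof. by apply/funext => eta; rewrite indicE mem_setE. Qed.

Lemma Rintegral_pred (P : config -> bool) :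
  measurable [set eta | P eta] -> \int[mu]_eta ((P eta)%:R : R) = prob P.
Proof.
move=> mP; rewrite natr_indic /Rintegral /prob.
by rewrite integral_indic// setIT.
Qed.

Lemma integrable_pred (P : config -> bool) : measurable [set eta | P eta] ->
  mu.-integrable setT (EFin \o (fun eta => (P eta)%:R : R)).
Proof. by rewrite natr_indic; exact: integrable_indic. Qed.

(* L applied to the indicator of P has integral 0; off the null event P it is
   nonnegative, and on Q it is at least q. *)
Lemma measure0_inflow (sP sQ : seq int) (P Q : config -> bool) (i : int)
    (q : R) :
  determined_by sP P -> determined_by sQ Q -> 0 < q ->
  mu [set eta | P eta] = 0%E ->
  (forall eta, Q eta -> q <= fasep_rate p i eta /\ P (exchange i eta)) ->
  mu [set eta | Q eta] = 0%E.
Proof.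
move=> dP dQ q0 P0 QP; pose f eta : R := (P eta)%:R.
have cf : cylinder f by exact: cylinder_determined_by dP.
have [_ cLf _] := generator_cylinder f cf.
(* Each bond of [r] contributes a loss of at most 1, which gives [size r]; the additional 1 covers
   [q], which is at most a rate when [Q] occurs. *)
pose r := bonds sP; pose C : R := (size r)%:R + 1.
have LfE eta : fasep_op p f eta =
    \sum_(i <- r) fasep_rate p i eta * (f (exchange i eta) - f eta).
  apply: fasep_op_seq => [|j rj]; first exact: uniq_bonds.
  by rewrite /f (exchange_notin_bonds _ _ _ _ dP rj).
(* C f compensates the negative values of L f on the null event P. *)
have key eta : q * (Q eta)%:R <= fasep_op p f eta + C * f eta.
  have [Peta|nPeta] := boolP (P eta).
    have : - (size r)%:R <= fasep_op p f eta.
      rewrite LfE -sum1_size natr_sum -sumrN; apply: ler_sum => j _.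
      rewrite /f Peta; have := fasep_rate01 j eta.
      by case: (P (exchange j eta)); rewrite /=; lra.
    have : q * (Q eta)%:R <= 1.
      case: (boolP (Q eta)) => [/QP[qi _]|_]; last by rewrite mulr0.
      by rewrite mulr1 (le_trans qi)//; case/andP: (fasep_rate01 i eta).
    by rewrite /f Peta /C mulr1; lra.
  have terms j : 0 <= fasep_rate p j eta * (f (exchange j eta) - f eta).
    apply: mulr_ge0; first by case/andP: (fasep_rate01 j eta).
    by rewrite /f (negPf nPeta) subr0.
  rewrite {2}/f (negPf nPeta) mulr0 addr0 LfE.
  have [Qeta|nQeta] := boolP (Q eta); last first.
    by rewrite mulr0; exact: sumr_ge0.
  have [qi Pi] := QP eta Qeta.
  (* The exchange at [i] turns [P] from false to true, so the bond must meet [sP]. *)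
  have ri : i \in r.
    apply: contraT => ri.
    by move: Pi; rewrite (exchange_notin_bonds _ _ _ _ dP ri) (negPf nPeta).
  rewrite mulr1 (bigD1_seq i) ?uniq_bonds//=.
  apply: (le_trans qi); rewrite -[leLHS]addr0.
  apply: lerD; last exact: sumr_ge0.
  by rewrite /f Pi (negPf nPeta) subr0 mulr1.
have mP := measurable_determined_by _ _ dP.
have mQ := measurable_determined_by _ _ dQ.
have iP := integrable_pred _ mP; have iQ := integrable_pred _ mQ.
have iLf := continuous_integrable mu _ cLf.
have iCf := integrableZl measurableT C iP.
have : q * prob Q <= 0.
  have <- : \int[mu]_eta (fasep_op p f eta + C * f eta) = 0.
    rewrite RintegralD// integral_fasep_op// add0r RintegralZl//.
    by rewrite Rintegral_pred// /prob P0 mulr0.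
  rewrite -Rintegral_pred// -RintegralZl//; apply: le_Rintegral => //.
  - exact: (integrableZl measurableT q iQ).
  - exact: (integrableD measurableT iLf iCf).
rewrite pmulr_rle0// => Q0.
have finQ : mu [set eta | Q eta] \is a fin_num.
  by rewrite fin_num_measure.
apply/eqP; rewrite -(fineK finQ) eqe eq_le Q0.
by rewrite fine_ge0.
Qed.

(** * Countable unions, translation invariance and the rate of annihilation *)

Lemma negligible_bigcup_countable (I : countType) (F : I -> set config) :
  (forall i, mu.-negligible (F i)) -> mu.-negligible (\bigcup_i F i).
Proof.
move=> F0; pose G n := if unpickle n is Some i then F i else set0.
apply: (@negligibleS _ _ _ _ (\bigcup_n G n)); last first.
  apply: negligible_bigcup => n; rewrite /G.
  by case: unpickle => // ; exact: negligible_set0.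
by move=> eta [i _ Fi]; exists (pickle i) => //; rewrite /G pickleK.
Qed.

(** One translation moves the index by one without changing the measure; induction on the distance
    between [i] and [j] does the rest. *)
Lemma measure_shift (A : int -> set config) (i j : int) :
  (forall k, measurable (A k)) ->
  (forall k, translate @^-1` A k = A (k - 1)) -> mu (A i) = mu (A j).
Proof.
move=> mA shA; have step k n : mu (A (k - n%:Z)) = mu (A k).
  elim: n => [|n <-]; first by rewrite subr0.
  rewrite -(mu_TIS.1 _ (mA (k - n%:Z))) shA.
  by congr (mu (A _)); lia.
have [ij|ji] := leP i j.
- by rewrite -(step j (absz (j - i))); congr (mu (A _)); lia.
- by rewrite -(step i (absz (i - j))); congr (mu (A _)); lia.
Qed.

Lemma prob_shift (s : int -> seq int) (P : int -> config -> bool) (i j : int) :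
  (forall k, determined_by (s k) (P k)) ->
  (forall k eta, P k (translate eta) = P (k - 1) eta) ->
  prob (P i) = prob (P j).
Proof.
move=> sP shP; congr fine.
apply: (measure_shift (fun k => [set eta | P k eta])) => [k|k].
  exact: measurable_determined_by (sP k).
by apply/seteqP; split => eta /=; rewrite shP.
Qed.

Lemma integral_linear (I : Type) (r : seq I) (a : I -> R)
    (P : I -> config -> bool) :
  (forall i, measurable [set eta | P i eta]) ->
  mu.-integrable setT
    (EFin \o (fun eta => \sum_(i <- r) a i * (P i eta)%:R)) /\
  \int[mu]_eta (\sum_(i <- r) a i * (P i eta)%:R) =
  \sum_(i <- r) a i * prob (P i).
Proof.
move=> mP; pose F (r : seq I) eta := \sum_(i <- r) a i * (P i eta)%:R.
rewrite -/(F r); elim: r => [|i r [iF FE]].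
  have -> : F [::] = cst 0 by apply/funext => eta; rewrite /F big_nil.
  rewrite big_nil Rintegral_cst// mul0r; split=> //.
  exact: (continuous_integrable mu (cst 0) (fun=> @cvg_cst _ _ _ _ _)).
have iP := integrable_pred _ (mP i).
have iaP := integrableZl measurableT (a i) iP.
have -> : F (i :: r) = fun eta => a i * (P i eta)%:R + F r eta.
  by apply/funext => eta; rewrite /F big_cons.
split; first exact: (integrableD measurableT iaP iF).
by rewrite big_cons RintegralD// FE RintegralZl// Rintegral_pred.
Qed.

(** The pattern [w] is read from site [i] rightwards; the default [false] of [nth] is never
    reached. *)
Definition word (w : seq bool) (i : int) (eta : config) : bool :=
  all (fun k => eta (i + k%:Z) == nth false w k) (iota 0 (size w)).

Lemma word_determined_by w i :
  determined_by [seq i + k%:Z | k <- iota 0 (size w)] (word w i).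
Proof.
move=> eta xi h; apply: eq_in_all => k kw.
by rewrite h//; apply: map_f.
Qed.

Lemma prob_word_shift w i j : prob (word w i) = prob (word w j).
Proof.
apply: (prob_shift _ _ _ _ (word_determined_by w)) => k eta.
apply: eq_all => n; rewrite /translate; congr (eta _ == _); lia.
Qed.

(* Stationarity of the event eta 0 = eta 1 = 1. The gain and loss due to pairs
   that hop by two sites (1101 to 1011 and back) cancel by translation
   invariance; the remaining losses are the annihilations. *)
Lemma annihilation_rate :
  p * prob (word [:: true; true; false; false] 0) +
  (1 - p) * prob (word [:: false; false; true; true] (-2)) = 0.
Proof.
pose P := word [:: true; true] 0.
have dP : determined_by [:: 0; 1] P.
  exact: (word_determined_by [:: true; true] 0).
have := integral_fasep_op _ (cylinder_determined_by _ _ dP).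
pose w1 := [:: true; true; false; true].
pose w2 := [:: true; false; true; true].
pose w3 := [:: true; true; false; false].
pose w4 := [:: false; false; true; true].
(* Each entry is a signed rate, a pattern and its left end. The first four are gains and losses by
   hops of a pair, the last two are annihilations. *)
pose l : seq (R * (seq bool * int)) := [:: (p, (w1, -2)); (- p, (w1, 0));
  (1 - p, (w2, 0)); (- (1 - p), (w2, -2)); (- p, (w3, 0));
  (- (1 - p), (w4, -2))].
have -> : fasep_op p (fun eta => (P eta)%:R) =
    fun eta => \sum_(x <- l) x.1 * (word x.2.1 x.2.2 eta)%:R.
  apply/funext => eta; rewrite (fasep_op_seq [:: -1; 0; 1])//; last first.
    move=> i; rewrite !inE !negb_or => /and3P[i1 i2 i3].
    rewrite (exchange_notin_bonds _ _ _ _ dP)//.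
    by rewrite mem_undup !inE !negb_or i1 i2 i3.
  (* The rates and exchanges at the bonds -1, 0, 1 involve only the sites from -2 to 3, so a finite
     check suffices. *)
  rewrite !big_cons !big_nil /P /w1 /w2 /w3 /w4 /word/= /fasep_rate /exchange/=.
  case: (eta (-2)) => /=; case: (eta (-1)) => /=; case: (eta 0) => /=;
  case: (eta 1) => /=; case: (eta 2) => /=; case: (eta 3) => /=; lra.
rewrite (integral_linear _ l _ (fun x => word x.2.1 x.2.2) _).2; last first.
  by move=> x; exact: measurable_determined_by (word_determined_by _ _).
rewrite /l !big_cons big_nil/= (prob_word_shift w1 (-2) 0).
by rewrite (prob_word_shift w2 (-2) 0) -/w3 -/w4; lra.
Qed.

(* d is 1 or -1: the direction of motion under consideration. *)
Definition pair1 (d x : int) (eta : config) : bool := eta x && eta (x + d).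
Definition pair0 (d x : int) (eta : config) : bool :=
  ~~ eta x && ~~ eta (x + d).

Lemma measurable_pair1 d x : measurable [set eta | pair1 d x eta].
Proof.
apply: (measurable_determined_by [:: x; x + d]) => eta xi h.
by rewrite /pair1 !h// !inE eqxx ?orbT.
Qed.

Lemma measurable_pair0 d x : measurable [set eta | pair0 d x eta].
Proof.
apply: (measurable_determined_by [:: x; x + d]) => eta xi h.
by rewrite /pair0 !h// !inE eqxx ?orbT.
Qed.

Lemma prob_ge0 P : 0 <= prob P.
Proof. by rewrite /prob fine_ge0. Qed.

Lemma negligible_prob0 (P : config -> bool) : measurable [set eta | P eta] ->
  prob P = 0 -> mu.-negligible [set eta | P eta].
Proof.
move=> mP P0; apply/negligibleP => //.
by rewrite -[LHS]fineK ?fin_num_measure// -/(prob P) P0.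
Qed.

Lemma prob0_word w i :
  prob (word w 0) = 0 -> mu.-negligible [set eta | word w i eta].
Proof.
rewrite (prob_word_shift w 0 i); apply: negligible_prob0.
exact: measurable_determined_by (word_determined_by w i).
Qed.

(** * Pairs 11 and 00 do not coexist *)

Section Direction.
Context (d : int) (q : R) (q0 : 0 < q)
  (dq : (d = 1 /\ q = p) \/ (d = -1 /\ q = 1 - p)).

(* The particle at x + d jumps to x + 2d. *)
Lemma jump (x : int) : exists i : int, forall eta : config,
  pair1 d x eta -> ~~ eta (x + d * 2) ->
  q <= fasep_rate p i eta /\
  exchange i eta = fun j => if j == x + d * 2 then eta (x + d) else
    if j == x + d then eta (x + d * 2) else eta j.
Proof.
case: dq => -[-> ->].
- exists (x + 1) => eta /andP[ex ex1] ex2; split.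
    rewrite /fasep_rate addrK ex ex1.
    by rewrite (_ : x + 1 + 1 = x + 1 * 2) ?ex2 ?lexx//; lia.
  apply/funext => j; rewrite /exchange.
  have -> : x + 1 + 1 = x + 1 * 2 by lia.
  by case: (eqVneq j (x + 1 * 2)) => [->|_//]; rewrite ifN//; apply/eqP; lia.
- exists (x - 2) => eta /andP[ex ex1] ex2; split.
    have e2 : x + -1 * 2 = x - 2 by lia.
    have e1 : x - 2 + 1 = x - 1 by lia.
    have e0 : x - 2 + 2 = x by lia.
    rewrite e2 in ex2.
    by rewrite /fasep_rate e1 e0 (negPf ex2) ex ex1 andbF lexx.
  apply/funext => j; rewrite /exchange.
  have -> : x - 2 + 1 = x + -1 by lia.
  by have -> : x + -1 * 2 = x - 2 by lia.
Qed.

(** Strong induction on the distance [m]. Distance 2 is annihilation. From distance 4 on, either a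
    11 or a 00 lies closer, or the configuration starts with 1101, and a hop to 1011 brings the pair
    two sites nearer. *)
Lemma pair1_ahead_pair0 (m : nat) (x : int) :
  mu.-negligible [set eta | pair1 d x eta && pair0 d (x + d * m%:Z) eta].
Proof.
have base y : mu.-negligible
    [set eta | pair1 d y eta && pair0 d (y + d * 2) eta].
  have := annihilation_rate.
  set P3 := prob _; set P4 := prob _ => P34.
  have [P3_ge0 P4_ge0] := (prob_ge0 _ : 0 <= P3, prob_ge0 _ : 0 <= P4).
  have [pge0 ple1] := andP p01.
  have [p3 p4] : p * P3 = 0 /\ (1 - p) * P4 = 0.
    have : 0 <= p * P3 by exact: mulr_ge0.
    have : 0 <= (1 - p) * P4 by apply: mulr_ge0 => //; lra.
    by lra.
  have q1 := q0; case: dq => -[-> qE]; rewrite qE in q1.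
  - have {p3}/prob0_word P0 : P3 = 0.
      by move/eqP: p3; rewrite mulf_eq0 (gt_eqF q1) => /eqP.
    apply: negligibleS (P0 y) => eta /=.
    rewrite /pair1 /pair0 /word/= => /andP[/andP[e0 e1] /andP[e2 e3]].
    have -> : y + 2%:Z = y + 1 * 2 by lia.
    have -> : y + 3%:Z = y + 1 * 2 + 1 by lia.
    by rewrite addr0 e0 e1 (negPf e2) (negPf e3).
  - have {p4} : P4 = 0.
      by move/eqP: p4; rewrite mulf_eq0 (gt_eqF q1) => /eqP.
    rewrite /P4 (prob_word_shift _ (-2) 0) => /prob0_word P0.
    (* For [d = -1] the pattern 0011 ends at [y], hence starts at [y - 3]. *)
    apply: negligibleS (P0 (y - 3)) => eta /=.
    rewrite /pair1 /pair0 /word/= => /andP[/andP[e0 e1] /andP[e2 e3]].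
    have -> : y - 3 + 0%:Z = y + -1 * 2 + -1 by lia.
    have -> : y - 3 + 1%:Z = y + -1 * 2 by lia.
    have -> : y - 3 + 2%:Z = y + -1 by lia.
    have -> : y - 3 + 3%:Z = y by lia.
    by rewrite e0 e1 (negPf e2) (negPf e3).
elim/ltn_ind: m x => -[|[|[|[|k]]]] ih x.
(* At distances 0 and 1 the two pairs share a site: the event is empty and lies in any null set. *)
- by rewrite mulr0 addr0; apply: negligibleS (base x) => eta /=;
    rewrite /pair1 /pair0; case: (eta x); rewrite ?andbF.
- by rewrite mulr1; apply: negligibleS (base x) => eta /=;
    rewrite /pair1 /pair0 andbACA; case: (eta (x + d)); rewrite ?andbF.
- exact: base.
(* At distance 3 the site between the pairs extends the 00 if empty and the 11 if occupied; either
   way a distance of 2 results. *)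
- apply: negligibleS (negligibleU (base x) (base (x + d))) => eta /=.
  rewrite /pair1 /pair0 (_ : x + d * 3 = x + d * 2 + d); last by lia.
  rewrite (_ : x + d + d * 2 = x + d * 2 + d); last by lia.
  rewrite (_ : x + d + d = x + d * 2); last by lia.
  move=> /andP[/andP[-> ->] /andP[e3 e4]]; rewrite e3 e4 /= andbT.
  by case: (eta (x + d * 2)); [right|left].
pose D n y (eta : config) := pair1 d y eta && pair0 d (y + d * n%:Z) eta.
have dD n y : determined_by
    [:: y; y + d; y + d * n%:Z; y + d * n%:Z + d] (D n y).
  by move=> eta xi h; rewrite /D /pair1 /pair0 !h// !inE eqxx ?orbT.
(* The remaining case 1101 with 00 further ahead: the jump leads into the event for distance [k.+2],
   null by induction. *)
pose Q (eta : config) :=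
  [&& D k.+4 x eta, ~~ eta (x + d * 2) & eta (x + d * 3)].
have dQ : determined_by [:: x; x + d; x + d * k.+4%:Z; x + d * k.+4%:Z + d;
    x + d * 2; x + d * 3] Q.
  by move=> eta xi h; rewrite /Q /D /pair1 /pair0 !h// !inE eqxx ?orbT.
have Q0 : mu.-negligible [set eta | Q eta].
  have [i jump_i] := jump x.
  apply/negligibleP; first exact: measurable_determined_by dQ.
  apply: (measure0_inflow _ _ _ _ i _ (dD k.+2 (x + d * 2)) dQ q0).
    apply: measure_negligible; first exact: measurable_determined_by (dD _ _).
    by apply: ih; lia.
  move=> eta /and3P[/andP[e01 /andP[e4 e5]] e2 e3].
  have [qi ->] := jump_i eta e01 e2; split=> //.
  have d0 : d != 0 by case: dq => -[->].
  (* Distinct multiples of [d] give distinct sites, so the exchange of [x + d] and [x + d * 2]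
     leaves the 00 and the site [x + d * 3] untouched. *)
  have far (n m : nat) : n != m -> (x + d * n%:Z == x + d * m%:Z) = false.
    by move=> nm; apply/negbTE; apply: contra nm => /eqP/addrI/(mulfI d0)[->].
  rewrite /D /pair1 /pair0 eqxx; case/andP: e01 => _ ->.
  have -> : x + d * 2 + d = x + d * 3 by lia.
  have -> : x + d * 2 + d * k.+2 = x + d * k.+4%:Z by lia.
  have kE : x + d * k.+4%:Z + d = x + d * k.+4.+1%:Z by lia.
  have dE : x + d = x + d * 1%:Z by rewrite mulr1.
  rewrite kE in e5 *; rewrite dE (far k.+4 2%N) ?(far k.+4 1%N)//.
  rewrite (far k.+4.+1 2%N) ?(far k.+4.+1 1%N)//.
  by rewrite (far 3%N 2%N) ?(far 3%N 1%N)// e3 e4.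
apply: negligibleS (negligibleU (negligibleU (base x) Q0)
  (ih k.+3 (leqnn _) (x + d))) => eta /= De.
have /andP[e01 e45] := De; have /andP[e0 e1] := e01.
have [e2|e2] := boolP (eta (x + d * 2)).
  right; rewrite /pair1 e1 (_ : x + d + d = x + d * 2) ?e2/=; last by lia.
  by rewrite (_ : x + d + d * k.+3 = x + d * k.+4) ?e45//; lia.
left; have [e3|e3] := boolP (eta (x + d * 3)).
  by right; rewrite /Q /D De e2.
left; rewrite e01 /pair0 e2 (_ : x + d * 2 + d = x + d * 3) ?e3//.
by lia.
Qed.

(* Recurrence: the events B z, that some 11 lies at or behind z, increase with z
   (in direction d) and have equal probabilities, so up to a null set 11
   anywhere implies 11 behind y. *)
Lemma pair1_behind_pair0 (x y : int) :
  mu.-negligible [set eta | pair1 d x eta && pair0 d y eta].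
Proof.
have ahead n z : mu.-negligible
    [set eta | pair1 d (z - d * n%:Z) eta && pair0 d z eta].
  by have := pair1_ahead_pair0 n (z - d * n%:Z); rewrite subrK.
(* Either the 11 is behind the 00, which is settled by [ahead], or it is in front and recurrence is
   needed. *)
have [[n xE]|[n yE]] : (exists n : nat, x = y - d * n%:Z) \/
    (exists n : nat, y = x - d * n%:Z).
  case: dq => -[-> _]; have [xy|yx] := leP x y.
  - by left; exists (absz (y - x)); lia.
  - by right; exists (absz (x - y)); lia.
  - by right; exists (absz (y - x)); lia.
  - by left; exists (absz (x - y)); lia.
  by rewrite xE; exact: ahead.
pose B z := \bigcup_n [set eta | pair1 d (z - d * n%:Z) eta].
have mB z : measurable (B z).
  by apply: bigcupT_measurable => k; exact: measurable_pair1.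
have shB z : translate @^-1` B z = B (z - 1).
  apply/seteqP; split=> eta [k _] /= h; exists k => //=; move: h;
    rewrite /pair1 /translate /=.
    have -> : z - d * k%:Z - 1 = z - 1 - d * k%:Z by lia.
    by have -> : z - d * k%:Z + d - 1 = z - 1 - d * k%:Z + d by lia.
  have -> : z - d * k%:Z - 1 = z - 1 - d * k%:Z by lia.
  by have -> : z - d * k%:Z + d - 1 = z - 1 - d * k%:Z + d by lia.
have yx : B y `<=` B x.
  move=> eta [m _] h; exists (n + m)%N => //; move: h; rewrite /= yE.
  by have -> : x - d * n%:Z - d * m%:Z = x - d * (n + m)%N%:Z by lia.
have Bxy : mu.-negligible (B x `\` B y).
  apply/negligibleP; first exact: measurableD.
  rewrite measureD ?(setIidr yx)//; last first.
    by apply: (le_lt_trans (probability_le1 mu (mB x))); rewrite ltry.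
  rewrite [X in (_ - X)%E](measure_shift B y x mB shB).
  by rewrite subee// fin_num_measure.
have By0 : mu.-negligible (\bigcup_n
    [set eta | pair1 d (y - d * n%:Z) eta && pair0 d y eta]).
  by apply: negligible_bigcup => k; exact: ahead.
apply: negligibleS (negligibleU Bxy By0) => eta /= /andP[ex ey].
have [[k _ h]|nBy] := pselect (B y eta).
  by right; exists k => //=; rewrite h.
by left; split=> //; exists 0%N => //=; rewrite mulr0 subr0.
Qed.

End Direction.

(** Particles move right if [p > 0] and left otherwise, so one direction always applies; there are
    countably many positions for the two pairs. *)
Lemma adjacent_particles_and_holes :
  mu.-negligible (~` (frozen `|` no_adjacent_holes)).
Proof.
have pairs x y : mu.-negligible
    [set eta | [&& eta x, eta (x + 1), ~~ eta y & ~~ eta (y + 1)]].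
  have [p0 p1] := andP p01.
  have [pgt0|ple0] := ltP 0 p.
    apply: negligibleS
      (pair1_behind_pair0 1 p pgt0 (or_introl (conj erefl erefl)) x y).
    by move=> eta /=; rewrite /pair1 /pair0 => /and4P[-> -> -> ->].
  have q0 : 0 < 1 - p by lra.
  (* For [d = -1] a pair is indexed by its right end, whence the shift by one. *)
  apply: negligibleS (pair1_behind_pair0 (-1) _ q0
    (or_intror (conj erefl erefl)) (x + 1) (y + 1)).
  by move=> eta /=; rewrite /pair1 /pair0 !addrK => /and4P[-> -> -> ->].
apply: negligibleS
  (negligible_bigcup_countable _ _ (fun xy => pairs xy.1 xy.2)).
move=> eta; rewrite /frozen /no_adjacent_holes /= => /not_orP[].
move=> /existsNP[x /negP]; rewrite negbK => /andP[ex ex1].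
move=> /existsNP[y /negP]; rewrite negb_or => /andP[ey ey1].
by exists (x, y) => //=; rewrite ex ex1 ey ey1.
Qed.

(** * Measurability and translation invariance of the two sets of configurations *)

Lemma measurable_forall (P : int -> config -> bool) :
  (forall i, measurable [set eta | P i eta]) ->
  measurable [set eta | forall i, P i eta].
Proof.
move=> mP; rewrite -[X in measurable X]setCK; apply: measurableC.
have -> : ~` [set eta | forall i, P i eta] =
    \bigcup_i ~` [set eta | P i eta].
  rewrite -setC_bigcap; congr (~` _).
  by apply/seteqP; split => [eta h i _|eta h i]; exact: h.
apply: countable_bigcupT_measurable => [|i]; first exact: countableP.
by apply: measurableC; exact: mP.
Qed.

Lemma measurable_site i : measurable [set eta : config | eta i].
Proof.
apply: (measurable_determined_by [:: i]) => eta xi; apply.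
by rewrite inE.
Qed.

Lemma measurable_and (P Q : config -> bool) :
  measurable [set eta | P eta] -> measurable [set eta | Q eta] ->
  measurable [set eta | P eta && Q eta].
Proof.
move=> mP mQ; rewrite (_ : mkset _ = [set eta | P eta] `&` [set eta | Q eta]).
  exact: measurableI.
by apply/seteqP; split => eta /=; [move=> /andP|case=> -> ->].
Qed.

Lemma measurable_frozen : measurable frozen.
Proof.
apply: measurable_forall => i.
apply: (measurable_determined_by [:: i; i + 1]) => eta xi h.
by rewrite !h// !inE eqxx ?orbT.
Qed.

Lemma measurable_no_adjacent_holes : measurable no_adjacent_holes.
Proof.
apply: measurable_forall => i.
apply: (measurable_determined_by [:: i; i + 1]) => eta xi h.
by rewrite !h// !inE eqxx ?orbT.
Qed.

Lemma translate_frozen : translate @^-1` frozen = frozen.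
Proof.
apply/seteqP; split=> eta h i.
  by have := h (i + 1); rewrite /translate addrK addrAC addrK.
by have := h (i - 1); rewrite /translate addrAC.
Qed.

Lemma translate_no_adjacent_holes :
  translate @^-1` no_adjacent_holes = no_adjacent_holes.
Proof.
apply/seteqP; split=> eta h i.
  by have := h (i + 1); rewrite /translate addrK addrAC addrK.
by have := h (i - 1); rewrite /translate addrAC.
Qed.

(** * Consequences of the density *)

Context (rho : R) (mu_density : has_density mu rho).

(** By invariance, the window averages of the indicators of [P j] all have integral [prob (P i)].
    They converge almost surely to [rho] times the indicator of [A], and dominated convergence
    identifies the integrals. *)
Lemma prob_site_invariant (A : set config) (i : int) :
  measurable A -> translate @^-1` A = A ->
  prob (fun eta => eta i && (eta \in A)) = rho * prob (fun eta => eta \in A).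
Proof.
move=> mA shA; pose P j (eta : config) := eta j && (eta \in A).
have mA' : measurable [set eta | eta \in A] by rewrite set_mem_set.
have mP j : measurable [set eta | P j eta].
  by apply: measurable_and => //; exact: measurable_site.
have shP j : prob (P j) = prob (P i).
  congr fine; apply: (measure_shift (fun k => [set eta | P k eta])) => // k.
  have inA eta : (translate eta \in A) = (eta \in A).
    by rewrite -[in RHS]shA; apply/idP/idP; rewrite !inE.
  by apply/seteqP; split => eta /=; rewrite /P inA.
pose c (N : nat) : R := (2 * N + 1)%:R^-1.
pose avg N eta := \sum_(k < 2 * N + 1) c N * (P (k%:Z - N%:Z) eta)%:R.
have cN N : c N * (2 * N + 1)%:R = 1.
  by rewrite mulVf// pnatr_eq0 addn1.
have intavg N : mu.-integrable setT (EFin \o avg N) /\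
    \int[mu]_eta avg N eta = prob (P i).
  have [iF FE] := integral_linear _ (index_enum 'I_(2 * N + 1)) (fun=> c N)
    (fun k => P (k%:Z - N%:Z)) (fun k => mP _).
  split; first exact: iF.
  rewrite FE; under eq_bigr do rewrite shP.
  by rewrite sumr_const card_ord -mulr_natl mulrA (mulrC _ (c N)) cN mul1r.
have avg01 N eta : 0 <= avg N eta <= 1.
  have c0 : 0 <= c N by rewrite invr_ge0.
  apply/andP; split; first by apply: sumr_ge0 => k _; exact: mulr_ge0.
  rewrite -(cN N) mulrC mulr_natl -[X in _ *+ X]card_ord -sumr_const.
  by apply: ler_sum => k _; rewrite ler_piMr// lern1 leq_b1.
have avg_cvg : {ae mu, forall eta, setT eta ->
    (EFin \o avg N) eta @[N --> \oo] --> (rho * (eta \in A)%:R)%:E}.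
  apply: filterS mu_density => eta etarho _.
  suff avgrho : avg^~ eta @ \oo --> rho * (eta \in A)%:R.
    by apply: cvg_EFin => //; exact: nearW.
  have -> : avg^~ eta = (fun N => c N *
      (\sum_(k < 2 * N + 1) (eta (k%:Z - N%:Z))%:R) * (eta \in A)%:R).
    apply/funext => N; rewrite /avg -mulr_sumr -mulrA mulr_suml; congr (_ * _).
    by apply: eq_bigr => k _; rewrite /P -natrM mulnb.
  by apply: cvgM; [exact: etarho|exact: cvg_cst].
pose f (eta : config) : \bar R := (rho * (eta \in A)%:R)%:E.
have iA := integrable_pred _ mA'.
have mf : measurable_fun setT f.
  exact: measurable_int (integrableZl measurableT rho iA).
have i1 : mu.-integrable setT (EFin \o cst (1 : R)).
  by apply: continuous_integrable => eta; exact: cvg_cst.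
have avg_le1 : {ae mu, forall eta N, setT eta ->
    (`|(EFin \o avg N) eta| <= (EFin \o cst 1%R) eta)%E}.
  apply: aeW => eta N _ /=; have /andP[a0 a1] := avg01 N eta.
  by rewrite lee_fin ger0_norm.
have [_ _ lim_int] := dominated_convergence measurableT
  (fun N => measurable_int _ (intavg N).1) mf avg_cvg i1 avg_le1.
have int_cst N : (\int[mu]_eta (EFin \o avg N) eta = (prob (P i))%:E)%E.
  by rewrite -(intavg N).2 fineK// integrable_fin_num// (intavg N).1.
have intf : (\int[mu]_eta f eta = (prob (P i))%:E)%E.
  rewrite -(cvg_lim (@ereal_hausdorff R) lim_int).
  by under eq_fun do rewrite int_cst; rewrite lim_cst.
have -> : prob (P i) = \int[mu]_eta (rho * (eta \in A)%:R).
  by rewrite /Rintegral intf.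
by rewrite RintegralZl// Rintegral_pred.
Qed.

(** Pointwise, 1 plus the indicator of 11 equals [eta i + eta (i + 1)] plus the indicator of 00;
    multiply by the indicator of [A] and integrate. *)
Lemma prob_inclusion_exclusion (A : set config) (i : int) :
  measurable A -> translate @^-1` A = A ->
  prob (fun eta => eta \in A) +
  prob (fun eta => pair1 1 i eta && (eta \in A)) =
  rho * prob (fun eta => eta \in A) *+ 2 +
  prob (fun eta => pair0 1 i eta && (eta \in A)).
Proof.
move=> mA shA.
have mA' : measurable [set eta | eta \in A] by rewrite set_mem_set.
have iA := integrable_pred _ mA'.
have m1 := measurable_and _ _ (measurable_pair1 1 i) mA'.
have m0 := measurable_and _ _ (measurable_pair0 1 i) mA'.
have ms j := measurable_and _ _ (measurable_site j) mA'.
have [i1 i0] := (integrable_pred _ m1, integrable_pred _ m0).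
have [is0 is1] := (integrable_pred _ (ms i), integrable_pred _ (ms (i + 1))).
rewrite mulr2n -{1}(prob_site_invariant A i)//.
rewrite -(prob_site_invariant A (i + 1))//.
rewrite -!Rintegral_pred// -!RintegralD//; last first.
  exact: (integrableD measurableT is0 is1).
apply: eq_Rintegral => eta _; rewrite /pair1 /pair0.
by case: (eta i); case: (eta (i + 1)); case: (eta \in A); rewrite /=; lra.
Qed.

Lemma prob_false (P : config -> bool) : (forall eta, ~~ P eta) -> prob P = 0.
Proof.
move=> P0; rewrite /prob (_ : mkset _ = set0) ?measure0//.
by apply/seteqP; split => eta //=; rewrite (negPf (P0 eta)).
Qed.

(** The 00 term vanishes here. The sign of the factor [rho * 2 - 1] then separates the three
    regimes. *)
Lemma prob_no_adjacent_holes (i : int) :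
  prob (fun eta => pair1 1 i eta && (eta \in no_adjacent_holes)) =
  (rho * 2 - 1) * prob (fun eta => eta \in no_adjacent_holes).
Proof.
have := prob_inclusion_exclusion _ i measurable_no_adjacent_holes
  translate_no_adjacent_holes.
rewrite (prob_false (fun eta => pair0 1 i eta && _)); first by lra.
move=> eta; apply/negP => /andP[/andP[e0 e1]]; rewrite inE => /(_ i).
by rewrite (negPf e0) (negPf e1).
Qed.

Lemma prob_frozen (i : int) :
  prob (fun eta => pair0 1 i eta && (eta \in frozen)) =
  (1 - rho * 2) * prob (fun eta => eta \in frozen).
Proof.
have := prob_inclusion_exclusion _ i measurable_frozen translate_frozen.
rewrite (prob_false (fun eta => pair1 1 i eta && _)); first by lra.
move=> eta; apply/negP => /andP[e01]; rewrite inE => /(_ i).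
by rewrite -/(pair1 1 i eta) e01.
Qed.

(** * The three density regimes *)

Lemma probability1 (A : set config) :
  measurable A -> mu.-negligible (~` A) -> mu A = 1%E.
Proof.
move=> mA /(measure_negligible (measurableC mA)) A0.
by rewrite -[A]setCK probability_setC ?A0 ?sube0//; exact: measurableC.
Qed.

(** A probability equals a negative factor times that of [no_adjacent_holes], so the latter is 0 and
    only [frozen] remains. *)
Lemma frozen_low_density : rho < 2^-1 -> mu frozen = 1%E.
Proof.
move=> rholt; apply: probability1; first exact: measurable_frozen.
have G0 : mu.-negligible no_adjacent_holes.
  rewrite -(set_mem_set no_adjacent_holes).
  have mG : measurable [set eta | eta \in no_adjacent_holes].
    by rewrite set_mem_set; exact: measurable_no_adjacent_holes.
  apply: negligible_prob0 => //; have := prob_no_adjacent_holes 0.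
  set P1 := prob _; set PG := prob _ => PE.
  have [P1ge0 PGge0] : 0 <= P1 /\ 0 <= PG by split; exact: prob_ge0.
  by nra.
apply: negligibleS (negligibleU adjacent_particles_and_holes G0) => eta nF.
by have [G|nG] := pselect (no_adjacent_holes eta); [right|left; case].
Qed.

Lemma no_adjacent_holes_high_density :
  rho > 2^-1 -> mu no_adjacent_holes = 1%E.
Proof.
move=> rhogt; apply: probability1; first exact: measurable_no_adjacent_holes.
have F0 : mu.-negligible frozen.
  rewrite -(set_mem_set frozen).
  have mF : measurable [set eta | eta \in frozen].
    by rewrite set_mem_set; exact: measurable_frozen.
  apply: negligible_prob0 => //; have := prob_frozen 0.
  set P0 := prob _; set PF := prob _ => PE.
  have [P0ge0 PFge0] : 0 <= P0 /\ 0 <= PF by split; exact: prob_ge0.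
  by nra.
apply: negligibleS (negligibleU adjacent_particles_and_holes F0) => eta nG.
by have [F|nF] := pselect (frozen eta); [right|left; case].
Qed.

(** Both factors vanish: almost surely there is no 11 within [no_adjacent_holes] and no 00 within
    [frozen], so neighbours always differ. *)
Lemma alternating_half_density : rho = 2^-1 ->
  mu.-negligible [set eta | exists i : int, eta i = eta (i + 1)].
Proof.
move=> rhoE; have rho2 : rho * 2 = 1 by rewrite rhoE mulVf.
have mG : measurable [set eta | eta \in no_adjacent_holes].
  by rewrite set_mem_set; exact: measurable_no_adjacent_holes.
have mF : measurable [set eta | eta \in frozen].
  by rewrite set_mem_set; exact: measurable_frozen.
have G1 i : mu.-negligible
    [set eta | pair1 1 i eta && (eta \in no_adjacent_holes)].
  apply: negligible_prob0.
    by apply: measurable_and => //; exact: measurable_pair1.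
  by rewrite prob_no_adjacent_holes rho2 subrr mul0r.
have F0 i : mu.-negligible [set eta | pair0 1 i eta && (eta \in frozen)].
  apply: negligible_prob0.
    by apply: measurable_and => //; exact: measurable_pair0.
  by rewrite prob_frozen rho2 subrr mul0r.
apply: negligibleS (negligible_bigcup_countable _ _ (fun i =>
  negligibleU adjacent_particles_and_holes (negligibleU (G1 i) (F0 i)))).
move=> eta [i ei]; exists i => //=.
have [F|nF] := pselect (frozen eta).
  right; right; have := F i; rewrite /pair0 -ei andbb => ->.
  by rewrite inE.
have [G|nG] := pselect (no_adjacent_holes eta); last by left; case.
right; left; have := G i; rewrite /pair1 -ei orbb => ->.
by rewrite inE.
Qed.

(** * Alternating configurations and identification of the measure at density one half *)

Lemma alternating_eq (eta xi : config) :
  (forall i, eta (i + 1) = ~~ eta i) -> (forall i, xi (i + 1) = ~~ xi i) ->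
  eta 0 = xi 0 -> eta = xi.
Proof.
move=> alt_eta alt_xi e0; have H (n : nat) :
    eta n%:Z = xi n%:Z /\ eta (- n%:Z) = xi (- n%:Z).
  elim: n => [|n [ihp ihm]]; first by rewrite oppr0.
  split; first by rewrite -addn1 PoszD alt_eta alt_xi ihp.
  apply: negb_inj; rewrite -alt_eta -alt_xi.
  by have -> : - n.+1%:Z + 1 = - n%:Z by lia.
apply/funext => -[n|n]; first exact: (H n).1.
by rewrite NegzE; exact: (H n.+1).2.
Qed.

Lemma eta_star_alternating i : eta_star (i + 1) = ~~ eta_star i.
Proof. by rewrite /eta_star; lia. Qed.

Lemma translate_eta_star : translate eta_star = fun i => ~~ eta_star i.
Proof.
by apply/funext => i; rewrite -[in RHS](subrK 1 i) eta_star_alternating negbK.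
Qed.

Lemma measurable_set1_config (xi : config) : measurable [set xi].
Proof.
have -> : [set xi] = [set eta | forall i, eta i == xi i].
  apply/seteqP; split => eta /= h; first by rewrite h.
  by apply/funext => i; exact/eqP.
apply: measurable_forall => i.
by apply: (measurable_determined_by [:: i]) => eta eta' ->; rewrite ?inE.
Qed.

(** Up to a null set only the two alternating configurations remain; translation swaps them, so they
    carry equal mass. *)
Lemma half_density : rho = 2^-1 -> forall A : set config, measurable A ->
  mu A = mu_star R A.
Proof.
move=> /alternating_half_density alt.
set e0 : config := eta_star; set e1 : config := translate eta_star.
have e01 : e0 <> e1.
  move=> /(congr1 (fun eta : config => eta 0)).
  by rewrite /e1 translate_eta_star /e0; case: (eta_star 0).
have te1 : translate e1 = e0.
  apply/funext => i; rewrite /translate /e1 translate_eta_star.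
  by rewrite -eta_star_alternating subrK.
have mE xi := measurable_set1_config xi.
have mu10 : mu [set e1] = mu [set e0].
  rewrite -(mu_TIS.1 _ (mE e1)); congr (mu _).
  apply/seteqP; split => eta /=; last by move=> ->.
  move=> h; apply/funext => i.
  move: h => /(congr1 (fun xi : config => xi (i + 1))).
  by rewrite /e1 /translate addrK.
have alt0 A : measurable A -> mu ((A `\ e0) `\ e1) = 0%E.
  move=> mA; apply: measure_negligible; first by do 2 apply: measurableD => //.
  apply: negligibleS alt => eta [[_ ne0] ne1] /=; apply: contrapT => alt_eta.
  have {}alt_eta i : eta (i + 1) = ~~ eta i.
    have : eta i != eta (i + 1) by apply/eqP => ei; apply: alt_eta; exists i.
    by case: (eta i); case: (eta (i + 1)).
  have alt1 i : e1 (i + 1) = ~~ e1 i.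
    by rewrite /e1 translate_eta_star eta_star_alternating.
  have [eta0|eta0] := eqVneq (eta 0) (e0 0).
    by apply: ne0; exact: alternating_eq alt_eta eta_star_alternating eta0.
  apply: ne1; apply: alternating_eq alt_eta alt1 _.
  rewrite /e1 translate_eta_star; move: eta0; rewrite /e0.
  by case: (eta 0); case: (eta_star 0).
have muI1 A xi : mu (A `&` [set xi]) = (mu [set xi] * (xi \in A)%:R%:E)%E.
  have [xiA|xiA] := boolP (xi \in A).
    by rewrite mule1; congr (mu _); apply/setIidr => _ ->; rewrite -in_setE.
  rewrite mule0 (_ : _ `&` _ = set0) ?measure0//.
  by apply/seteqP; split => // eta [+ e]; rewrite e -in_setE (negPf xiA).
have muE A : measurable A ->
    mu A = (mu [set e0] * ((e0 \in A)%:R + (e1 \in A)%:R)%:E)%E.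
  move=> mA; rewrite (measureDI mu mA (mE e0)).
  rewrite (measureDI mu (measurableD mA (mE e0)) (mE e1)).
  rewrite [X in (X + _ + _)%E](alt0 A mA) add0e.
  have -> : (A `\ e0) `&` [set e1] = A `&` [set e1].
    apply/seteqP; split => eta [] /=; first by case.
    by move=> Aeta e; split=> //; split=> //=; rewrite e => /esym.
  rewrite [X in (X + _)%E]muI1 [X in (_ + X)%E]muI1 mu10 addeC.
  by rewrite -ge0_muleDr ?lee_fin.
have mu_e0 : mu [set e0] = (2^-1)%:E.
  (* On the whole space the formula reads 1 = 2 [r], where [r] is the mass of [e0]. *)
  have := muE _ measurableT; rewrite !in_setT.
  rewrite [LHS](probability_setT mu).
  rewrite -(fineK (fin_num_measure mu _ (mE e0))) => -[].
  set r := fine _.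
  by move=> rE; congr _%:E; lra.
move=> A mA; rewrite muE// mu_e0.
rewrite -[RHS]/((2^-1)%:E *
  measure_add \d_eta_star \d_(translate eta_star) A)%E.
rewrite measure_addE EFinD; congr (_ * (_ + _))%E; exact: esym (diracE _ _).
Qed.

End StationaryMeasure.

Theorem theorem2p5 (R : realType) (p : R) (p01 : 0 <= p <= 1)
    (S : R -> (config -> R) -> (config -> R)) (hS : fasep_semigroup p S)
    (mu : probability config R) (rho : R)
    (mu_TIS : TIS S mu) (mu_density : has_density mu rho) :
  [/\ (rho < 2^-1 -> mu frozen = 1%E),
      (rho = 2^-1 -> forall A : set config, measurable A ->
         mu A = mu_star R A) &
      (rho > 2^-1 -> mu no_adjacent_holes = 1%E)].
Proof.
split.
- exact: (frozen_low_density _ p01 _ hS _ mu_TIS _ mu_density).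
- exact: (half_density _ p01 _ hS _ mu_TIS _ mu_density).
- exact: (no_adjacent_holes_high_density _ p01 _ hS _ mu_TIS _ mu_density).
Qed.
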